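(* Let $N=2m$ with $m\ge 1$, and let $\mathcal T\in\mathbb H^{I_1\times I_2\times\cdots\times I_N}$ be a quaternion tensor. Let the unitary matrices $\mathbf U_i\in\mathbb H^{I_i\times I_i}$ ($i=m,m-1,\ldots,1$), $\mathbf V_j\in\mathbb H^{I_j\times I_j}$ ($j=m+1,\ldots,N$), the intermediate tensors $\mathcal L_i$, $\mathcal R_j$, and the core tensor $\mathcal S$ be generated by the TS-QHOSVD procedure applied to $\mathcal T$ (described in the context). Then $$\mathcal T=\mathbf U_m\times_m^L\cdots\,\mathbf U_1\times_1^L\mathcal S\times_N^R\mathbf V_N^H\cdots\times_{m+1}^R\mathbf V_{m+1}^H .$$ Moreover, the core tensor $\mathcal S\in\mathbb H^{I_1\times\cdots\times I_N}$ has the following properties, where $\mathcal S_{i_k=\alpha}$ denotes the $(N-1)$-th order subtensor of $\mathcal S$ obtained by fixing the $k$-th index to be $\alpha$. (i) Ordering: for every $p=1,\ldots,m$ and every $q=m+1,\ldots,N$, $$\|\mathcal S_{i_p=1}\|_F=(\sigma_1^L)^{(p)}\ge\|\mathcal S_{i_p=2}\|_F=(\sigma_2^L)^{(p)}\ge\cdots\ge\|\mathcal S_{i_p=I_p}\|_F=(\sigma_{I_p}^L)^{(p)}\ge 0,$$ $$\|\mathcal S_{i_q=1}\|_F=(\sigma_1^R)^{(q)}\ge\|\mathcal S_{i_q=2}\|_F=(\sigma_2^R)^{(q)}\ge\cdots\ge\|\mathcal S_{i_q=I_q}\|_F=(\sigma_{I_q}^R)^{(q)}\ge 0,$$ where $(\sigma_k^L)^{(p)}$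 are the singular values of $(\mathbf L_{p+1})^L_{[p]}$ in descending order and $(\sigma_k^R)^{(q)}$ are the singular values of $(\mathbf R_{q-1})^R_{[q]}$ in descending order. (ii) Orthogonality: left orthogonality holds in mode $1$ and right orthogonality holds in mode $N$, i.e. for all $\alpha\ne\beta$, $$\langle\mathcal S_{i_1=\alpha},\mathcal S_{i_1=\beta}\rangle_L=0,\qquad \langle\mathcal S_{i_N=\alpha},\mathcal S_{i_N=\beta}\rangle_R=0 .$$ (iii) Weak orthogonality: for every $k=1,\ldots,N$ and all $\alpha\ne\beta$, $$\mathrm{Re}\,\langle\mathcal S_{i_k=\alpha},\mathcal S_{i_k=\beta}\rangle_L=\mathrm{Re}\,\langle\mathcal S_{i_k=\alpha},\mathcal S_{i_k=\beta}\rangle_R=0 .$$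
   Context: $\mathbb H$ denotes the (non-commutative) real quaternions, $\bar q$ the quaternion conjugate, $|q|=\sqrt{q\bar q}$, $\mathrm{Re}(q)$ the real part; $(\cdot)^T$ is the transpose (without conjugation) and $(\cdot)^H$ the conjugate transpose of a quaternion matrix. A square quaternion matrix $\mathbf U$ is unitary if $\mathbf U^H\mathbf U=\mathbf I$. Inner products and norm. For $\mathcal A,\mathcal B\in\mathbb H^{I_1\times\cdots\times I_N}$: $\langle\mathcal A,\mathcal B\rangle_L=\sum a_{i_1\cdots i_N}\bar b_{i_1\cdots i_N}$ and $\langle\mathcal A,\mathcal B\rangle_R=\sum\bar a_{i_1\cdots i_N}b_{i_1\cdots i_N}$ (sums over all indices), $\|\mathcal A\|_F^2=\langle\mathcal A,\mathcal A\rangle_L=\langle\mathcal A,\mathcal A\rangle_R$. $\mathcal A,\mathcal B$ are left orthogonal if $\langle\mathcal A,\mathcal B\rangle_L=0$, right orthogonal if $\langle\mathcal A,\mathcal B\rangle_R=0$, weakly orthogonal if $\mathrm{Re}\langle\mathcal A,\mathcal B\rangle_R=0$. Unfoldings. For $\mathcal T\in\mathbb H^{I_1\times\cdots\times I_N}$, the left mode-$k$ unfolding $\mathbf T^L_{[k]}\in\mathbb H^{I_k\times I_1\cdots I_{k-1}I_{k+1}\cdots I_N}$ has $(i_k,j)$ entry $t_{i_1\cdots i_N}$, where $j=1+\sum_{l\ne k}(i_l-1)J_l$, $J_l=\prod_{s<l,\,s\ne k}I_s$. The right mode-$k$ unfolding is $\mathbf T^R_{[k]}=(\mathbf T^L_{[k]})^T$.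 Unfoldings of tensors $\mathcal L_i,\mathcal R_j$ are written $(\mathbf L_i)^L_{[k]}$, $(\mathbf R_j)^R_{[k]}$, etc. Mode-$k$ products. For $\mathbf U\in\mathbb H^{J\times I_k}$, the left mode-$k$ product $\mathbf U\times_k^L\mathcal T$ has entries $(\mathbf U\times_k^L\mathcal T)_{i_1\cdots i_{k-1}ji_{k+1}\cdots i_N}=\sum_{i_k}u_{ji_k}t_{i_1\cdots i_N}$. For $\mathbf V\in\mathbb H^{I_k\times J}$, the right mode-$k$ product $\mathcal T\times_k^R\mathbf V$ has entries $(\mathcal T\times_k^R\mathbf V)_{i_1\cdots i_{k-1}ji_{k+1}\cdots i_N}=\sum_{i_k}t_{i_1\cdots i_N}v_{i_kj}$. In a chain of products, left products are applied starting with the one closest to the tensor (right to left) and right products starting with the one closest to the tensor (left to right); left products commute with right products by associativity. Quaternion SVD. Every quaternion matrix $\mathbf M$ can be written as $\mathbf M=\mathbf U\Sigma\mathbf V^H$ with $\mathbf U,\mathbf V$ unitary and $\Sigma$ real (rectangular) diagonal with non-negative diagonal entries (singular values) in descending order. TS-QHOSVD procedure ($N=2m$). Set $\mathcal L_{m+1}=\mathcal T=\mathcal R_m$. For $i=m,m-1,\ldots,1$: take an SVD $(\mathbf L_{i+1})^L_{[i]}=\mathbf U_i\Sigma_i^L\mathbf V_i^H$ with $\mathbf U_i\in\mathbb H^{I_i\times I_i}$ unitary (the left singular vectors), and set $\mathcal L_i=\mathbf U_i^H\times_i^L\mathcal L_{i+1}$. For $j=m+1,\ldots,N$: take an SVD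 $(\mathbf R_{j-1})^R_{[j]}=\mathbf U_j\Sigma_j^R\mathbf V_j^H$ with $\mathbf V_j\in\mathbb H^{I_j\times I_j}$ unitary (the right singular vectors), and set $\mathcal R_j=\mathcal R_{j-1}\times_j^R\mathbf V_j$. The core tensor is $$\mathcal S=\mathbf U_1^H\times_1^L\cdots\mathbf U_m^H\times_m^L\mathcal R_N=\mathbf U_1^H\times_1^L\cdots\mathbf U_m^H\times_m^L\mathcal T\times_{m+1}^R\mathbf V_{m+1}\cdots\times_N^R\mathbf V_N .$$ The singular values of $(\mathbf L_{p+1})^L_{[p]}$ are listed as $(\sigma_1^L)^{(p)}\ge\cdots\ge(\sigma_{I_p}^L)^{(p)}$ and those of $(\mathbf R_{q-1})^R_{[q]}$ as $(\sigma_1^R)^{(q)}\ge\cdots\ge(\sigma_{I_q}^R)^{(q)}$, with zeros appended if the unfolding has fewer than $I_p$ (resp. $I_q$) singular values. *)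

(* Defs.v *)
From HB Require Import structures.
From mathcomp Require Import all_boot all_order all_algebra.
From mathcomp Require Import reals.
From mathcomp Require Import ring.

Set Implicit Arguments.
Unset Strict Implicit.
Unset Printing Implicit Defensive.

Import Order.TTheory GRing.Theory Num.Theory.
Local Open Scope ring_scope.

Record quat (R : realType) : Type := Quat { qr : R; qi : R; qj : R; qk : R }.

Section QuaternionRing.
Variable R : realType.
Implicit Types x y z : quat R.

Definition quat_tuple x : R * R * R * R := (qr x, qi x, qj x, qk x).
Definition tuple_quat (u : R * R * R * R) : quat R :=
  Quat u.1.1.1 u.1.1.2 u.1.2 u.2.

Lemma quat_tupleK : cancel quat_tuple tuple_quat.
Proof. by case. Qed.

HB.instance Definition _ := Choice.copy (quat R) (can_type quat_tupleK).

Definition quat_zero : quat R := Quat 0 0 0 0.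
Definition quat_one : quat R := Quat 1 0 0 0.
Definition quat_opp x := Quat (- qr x) (- qi x) (- qj x) (- qk x).
Definition quat_add x y :=
  Quat (qr x + qr y) (qi x + qi y) (qj x + qj y) (qk x + qk y).
Definition quat_mul x y :=
  Quat (qr x * qr y - qi x * qi y - qj x * qj y - qk x * qk y)
       (qr x * qi y + qi x * qr y + qj x * qk y - qk x * qj y)
       (qr x * qj y - qi x * qk y + qj x * qr y + qk x * qi y)
       (qr x * qk y + qi x * qj y - qj x * qi y + qk x * qr y).

Lemma quat_addA : associative quat_add.
Proof. by case=> ? ? ? ? [? ? ? ?] [? ? ? ?]; congr Quat => /=; ring. Qed.
Lemma quat_addC : commutative quat_add.
Proof. by case=> ? ? ? ? [? ? ? ?]; congr Quat => /=; ring. Qed.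
Lemma quat_add0 : left_id quat_zero quat_add.
Proof. by case=> ? ? ? ?; congr Quat => /=; ring. Qed.
Lemma quat_addN : left_inverse quat_zero quat_opp quat_add.
Proof. by case=> ? ? ? ?; congr Quat => /=; ring. Qed.

HB.instance Definition _ :=
  GRing.isZmodule.Build (quat R) quat_addA quat_addC quat_add0 quat_addN.

Lemma quat_mulA : associative quat_mul.
Proof. by case=> ? ? ? ? [? ? ? ?] [? ? ? ?]; congr Quat => /=; ring. Qed.
Lemma quat_mul1 : left_id quat_one quat_mul.
Proof. by case=> ? ? ? ?; congr Quat => /=; ring. Qed.
Lemma quat_mulr1 : right_id quat_one quat_mul.
Proof. by case=> ? ? ? ?; congr Quat => /=; ring. Qed.
Lemma quat_mulDl : left_distributive quat_mul quat_add.
Proof. by case=> ? ? ? ? [? ? ? ?] [? ? ? ?]; congr Quat => /=; ring. Qed.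
Lemma quat_mulDr : right_distributive quat_mul quat_add.
Proof. by case=> ? ? ? ? [? ? ? ?] [? ? ? ?]; congr Quat => /=; ring. Qed.
Lemma quat_1neq0 : quat_one != quat_zero.
Proof. by apply/eqP => -[] /eqP; rewrite oner_eq0. Qed.

HB.instance Definition _ := GRing.Zmodule_isNzRing.Build (quat R)
  quat_mulA quat_mul1 quat_mulr1 quat_mulDl quat_mulDr quat_1neq0.

Definition quat_conj x : quat R := Quat (qr x) (- qi x) (- qj x) (- qk x).

Definition quat_real (a : R) : quat R := Quat a 0 0 0.

End QuaternionRing.

Definition mxH (R : realType) (p q : nat) (M : 'M[quat R]_(p, q)) :
    'M[quat R]_(q, p) :=
  map_mx (@quat_conj R) M^T.

Definition unitary (R : realType) (p : nat) (M : 'M[quat R]_p) : Prop :=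
  mxH M *m M = 1%:M.

(* The [k]-th (from 0) diagonal entry of a rectangular matrix, and 0 when [k]
   is beyond the end of its diagonal. *)
Definition diag_entry (R : realType) (p q : nat) (D : 'M[R]_(p, q)) (k : nat)
    : R :=
  if (insub k : option 'I_p, insub k : option 'I_q) is (Some i, Some j)
  then D i j else 0.

Record is_svd (R : realType) (p q : nat) (M : 'M[quat R]_(p, q))
    (U : 'M[quat R]_p) (D : 'M[R]_(p, q)) (V : 'M[quat R]_q) : Prop := IsSVD {
  svd_unitaryl : unitary U;
  svd_unitaryr : unitary V;
  svd_diag : is_diag_mx D;
  svd_ge0 : forall k : nat, 0 <= diag_entry D k;
  svd_sorted : forall k l : nat, (k <= l)%N -> diag_entry D l <= diag_entry D k;
  svd_eq : M = U *m map_mx (@quat_real R) D *m mxH V }.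

(* Modes and indices are numbered from 0. A multi-index of a tensor of order [N]
   with dimensions [I 0, ..., I (N - 1)] is a dependent finite function. *)
Definition index (N : nat) (I : 'I_N -> nat) : finType :=
  {dffun forall k : 'I_N, 'I_(I k)}.

Definition tensor (R : realType) (N : nat) (I : 'I_N -> nat) :=
  {ffun index I -> quat R}.

Section Tensors.
Variables (R : realType) (N : nat) (I : 'I_N -> nat).
Implicit Types (A B T : tensor R I) (i : index I).

Definition innerL A B : quat R := \sum_i A i * quat_conj (B i).
Definition innerR A B : quat R := \sum_i quat_conj (A i) * B i.

(* [<A, A>_L] is a nonnegative real, hence equal to its real part; see
   [normF_sqrL] and [normF_sqrR]. *)
Definition normF A : R := Num.sqrt (qr (innerL A A)).

Definition set_index (k : 'I_N) (a : 'I_(I k)) i : index I :=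
  [ffun l : 'I_N => dfwith i a l].

(* Only square factors are needed, so the dimensions of the tensor are
   unchanged. *)
Definition modeL (k : 'I_N) (U : 'M[quat R]_(I k)) T : tensor R I :=
  [ffun i : index I => \sum_(a < I k) U (i k) a * T (set_index a i)].
Definition modeR (k : 'I_N) T (V : 'M[quat R]_(I k)) : tensor R I :=
  [ffun i : index I => \sum_(a < I k) T (set_index a i) * V a (i k)].

(* [M_k1 x_k1 (M_k2 x_k2 ( ... T))] for [s = [:: k1; k2; ...]] *)
Definition chainL (s : seq 'I_N) (M : forall k : 'I_N, 'M[quat R]_(I k)) T :
    tensor R I :=
  foldr (fun k X => modeL (M k) X) T s.
(* [((T x_k1 M_k1) x_k2 M_k2) ...] for [s = [:: k1; k2; ...]] *)
Definition chainR (s : seq 'I_N) T (M : forall k : 'I_N, 'M[quat R]_(I k)) :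
    tensor R I :=
  foldl (fun X k => modeR X (M k)) T s.

Definition unfold_size (k : 'I_N) : nat := (\prod_(l < N | l != k) I l)%N.
Definition unfold_stride (k l : 'I_N) : nat :=
  (\prod_(s < N | (s < l) && (s != k)) I s)%N.
Definition unfold_col (k : 'I_N) i : nat :=
  (\sum_(l < N | l != k) i l * unfold_stride k l)%N.

(* The entry at [(a, b)] is [T i] for the multi-index [i] such that [i k = a]
   and [unfold_col k i = b], which exists and is unique; see
   [unfold_col_inj], [unfold_col_surj] and [unfoldLE]. *)
Definition unfoldL (k : 'I_N) T : 'M[quat R]_(I k, unfold_size k) :=
  \matrix_(a, b)
    (if [pick i : index I | (i k == a) && (unfold_col k i == b)] is Some i
     then T i else 0).
Definition unfoldR (k : 'I_N) T : 'M[quat R]_(unfold_size k, I k) :=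
  (unfoldL k T)^T.

(* [a] inserted at position [k] in a multi-index over the other modes *)
Definition insert_index (k : 'I_N) (a : 'I_(I k))
    (i : index (fun l : 'I_N.-1 => I (lift k l))) : index I :=
  [ffun l : 'I_N =>
    match unliftP k l with
    | UnliftSome l' e => ecast z 'I_(I z) (esym e) (i l')
    | UnliftNone e => ecast z 'I_(I z) (esym e) a
    end].

Definition slice (k : 'I_N) (a : 'I_(I k)) T :
    tensor R (fun l : 'I_N.-1 => I (lift k l)) :=
  [ffun i : index _ => T (insert_index a i)].

End Tensors.

Arguments slice {R N I} k a T.
Arguments unfoldL {R N I} k T.
Arguments unfoldR {R N I} k T.

Section Specifications.
Variables (R : realType) (N : nat) (I : 'I_N -> nat).
Implicit Types (A T : tensor R I) (i : index I).

Lemma quat_realD : {morph @quat_real R : a b / a + b}.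
Proof. by move=> a b; congr Quat => /=; ring. Qed.

Lemma quat_mul_conj (x : quat R) :
  x * quat_conj x = quat_real (qr x ^+ 2 + qi x ^+ 2 + qj x ^+ 2 + qk x ^+ 2).
Proof. by case: x => a b c d; congr Quat => /=; ring. Qed.

Lemma quat_conj_mul (x : quat R) : quat_conj x * x = x * quat_conj x.
Proof. by case: x => a b c d; congr Quat => /=; ring. Qed.

Lemma normF_sqrL A : innerL A A = quat_real (normF A ^+ 2).
Proof.
pose n (x : quat R) := qr x ^+ 2 + qi x ^+ 2 + qj x ^+ 2 + qk x ^+ 2.
have E : innerL A A = quat_real (\sum_i n (A i)).
  rewrite /innerL (big_morph _ quat_realD (erefl : quat_real 0 = 0)).
  by apply: eq_bigr => i _; rewrite quat_mul_conj.
rewrite /normF E sqr_sqrtr //= sumr_ge0 // => i _.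
by rewrite !addr_ge0 ?sqr_ge0.
Qed.

Lemma normF_sqrR A : innerR A A = quat_real (normF A ^+ 2).
Proof.
by rewrite -normF_sqrL; apply: eq_bigr => i _; rewrite quat_conj_mul.
Qed.

Definition partial_size (k : 'I_N) n := (\prod_(l < N | (l < n) && (l != k)) I l)%N.
Definition partial_col (k : 'I_N) i n :=
  (\sum_(l < N | (l < n) && (l != k)) i l * unfold_stride I k l)%N.

Lemma partial_last (k : 'I_N) n (nN : (n < N)%N) (l : 'I_N) :
  [&& (l < n.+1)%N && (l != k) & l != Ordinal nN] = (l < n)%N && (l != k).
Proof.
by rewrite -(inj_eq val_inj) /= ltnS andbAC [(l <= n)%N && _]andbC
  -ltn_neqAle.
Qed.

Lemma partial_skip (k : 'I_N) n (nN : (n < N)%N) (l : 'I_N) :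
  Ordinal nN = k -> (l < n.+1)%N && (l != k) = (l < n)%N && (l != k).
Proof.
move=> <-; rewrite -(inj_eq val_inj) /= ltnS.
by case: (ltngtP l n); rewrite ?andbF ?andbT.
Qed.

Lemma partial_sizeS (k : 'I_N) n (nN : (n < N)%N) : Ordinal nN != k ->
  partial_size k n.+1 = (I (Ordinal nN) * partial_size k n)%N.
Proof.
move=> nk; rewrite /partial_size (bigD1 (Ordinal nN)) /= ?nk ?ltnSn //.
by congr (_ * _)%N; apply: eq_bigl => l; exact: partial_last.
Qed.

Lemma partial_colS (k : 'I_N) i n (nN : (n < N)%N) : Ordinal nN != k ->
  partial_col k i n.+1 = (i (Ordinal nN) * partial_size k n + partial_col k i n)%N.
Proof.
move=> nk; rewrite /partial_col (bigD1 (Ordinal nN)) /= ?nk ?ltnSn //.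
by congr (_ + _)%N; apply: eq_bigl => l; exact: partial_last.
Qed.

Lemma partial_col_lt (k : 'I_N) i n : (n <= N)%N -> (partial_col k i n < partial_size k n)%N.
Proof.
elim: n => [_|n IHn nN]; first by rewrite /partial_col /partial_size !big_pred0.
have {IHn} lt := IHn (ltnW nN).
have [nk|nk] := eqVneq (Ordinal nN) k.
  have E l := partial_skip l nk.
  by rewrite /partial_col /partial_size !(eq_bigl _ _ E).
rewrite partial_colS // partial_sizeS //.
apply: (@leq_trans ((i (Ordinal nN)).+1 * partial_size k n)).
  by rewrite mulSn addnC ltn_add2r.
by rewrite leq_mul2r ltn_ord orbT.
Qed.

Lemma partial_col_inj (k : 'I_N) i i' n : (n <= N)%N -> partial_col k i n = partial_col k i' n ->
  forall l : 'I_N, (l < n)%N -> l != k -> i l = i' l.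
Proof.
elim: n => [//|n IHn nN]; have le := ltnW nN.
have [nk|nk] := eqVneq (Ordinal nN) k.
  have E l := partial_skip l nk.
  rewrite /partial_col !(eq_bigl _ _ E) => e l; rewrite ltnS leq_eqVlt => /orP[ln|ln].
    by rewrite -nk -(inj_eq val_inj) /= ln.
  exact: IHn.
rewrite !partial_colS // => e; have lt := partial_col_lt k i le; have lt' := partial_col_lt k i' le.
have p0 : (0 < partial_size k n)%N by apply: leq_ltn_trans lt.
have e1 : i (Ordinal nN) = i' (Ordinal nN).
  move/(congr1 (divn^~ (partial_size k n))): e.
  by rewrite !divnMDl // !divn_small // !addn0 => /val_inj.
move: e; rewrite e1 => /addnI e l; rewrite ltnS leq_eqVlt => /orP[ln _|ln].
  by have -> : l = Ordinal nN by apply: val_inj; apply/eqP.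
exact: IHn.
Qed.

Lemma unfold_col_lt (k : 'I_N) i : (unfold_col k i < unfold_size I k)%N.
Proof.
have := partial_col_lt k i (leqnn N); rewrite /partial_col /partial_size.
by congr (_ < _)%N; apply: eq_bigl => l; rewrite ltn_ord.
Qed.

Lemma unfold_col_inj (k : 'I_N) i i' :
  i k = i' k -> unfold_col k i = unfold_col k i' -> i = i'.
Proof.
have E j : unfold_col k j = partial_col k j N.
  by apply: eq_bigl => l; rewrite ltn_ord.
move=> ek; rewrite !E => /(partial_col_inj (leqnn N)) H; apply/ffunP => l.
by have [->|] := eqVneq l k => //; apply: H.
Qed.

Lemma card_index : #|index I| = (\prod_(k < N) I k)%N.
Proof.
rewrite card_dep_ffun foldrE big_image; apply: eq_bigr => k _.
exact: card_ord.
Qed.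

Lemma unfold_col_surj (k : 'I_N) (a : 'I_(I k)) (b : 'I_(unfold_size I k)) :
  exists i, i k = a /\ unfold_col k i = b.
Proof.
pose f i := (i k, Ordinal (unfold_col_lt k i)).
have f_inj : injective f.
  by move=> i i' [ek ec]; apply: unfold_col_inj ek ec.
have card_f : (#|{: 'I_(I k) * 'I_(unfold_size I k)}| <= #|index I|)%N.
  by rewrite card_prod !card_ord card_index (bigD1 k).
by have /codomP[i [-> ->]] := inj_card_onto f_inj card_f (a, b); exists i.
Qed.

Lemma unfoldLE (k : 'I_N) T i :
  unfoldL k T (i k) (Ordinal (unfold_col_lt k i)) = T i.
Proof.
rewrite mxE; case: pickP => [i' /andP[/eqP e /eqP e']|/(_ i)].
  by congr (T _); apply: unfold_col_inj e'.
by rewrite !eqxx.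
Qed.

Lemma insert_index_in (k : 'I_N) (a : 'I_(I k))
    (i : index (fun l => I (lift k l))) : insert_index a i k = a.
Proof.
rewrite ffunE; case: unliftP => [l e|e].
  by case/eqP: (neq_lift k l).
by rewrite eq_axiomK.
Qed.

Lemma insert_index_lift (k : 'I_N) (a : 'I_(I k))
    (i : index (fun l => I (lift k l))) (l : 'I_N.-1) :
  insert_index a i (lift k l) = i l.
Proof.
rewrite ffunE; case: unliftP => [l' e|e]; last first.
  by case/eqP: (neq_lift k l).
have el : l = l' := lift_inj e.
by case: l' / el e => e; rewrite eq_axiomK.
Qed.

End Specifications.

Definition left_modes (N m : nat) : seq 'I_N := [seq k : 'I_N <- enum 'I_N | (k < m)%N].
Definition right_modes (N m : nat) : seq 'I_N :=
  [seq k : 'I_N <- enum 'I_N | (m <= k)%N].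

(* Left mode [k] turns [L k.+1] into [L k], from [L m = T] down to [L 0], and
   right mode [k] turns [Rt k] into [Rt k.+1], from [Rt m = T] up to [Rt N].
   The values at the modes [m <= k] of [U], [DL] and [WL], and at the modes
   [k < m] of [V], [DR] and [WR], play no role. *)
Record ts_qhosvd (R : realType) (N m : nat) (I : 'I_N -> nat) (T : tensor R I)
    (L Rt : nat -> tensor R I)
    (U : forall k : 'I_N, 'M[quat R]_(I k))
    (DL : forall k : 'I_N, 'M[R]_(I k, unfold_size I k))
    (WL : forall k : 'I_N, 'M[quat R]_(unfold_size I k))
    (V : forall k : 'I_N, 'M[quat R]_(I k))
    (DR : forall k : 'I_N, 'M[R]_(unfold_size I k, I k))
    (WR : forall k : 'I_N, 'M[quat R]_(unfold_size I k))
    (S : tensor R I) : Prop := TsQhosvd {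
  ts_left_init : L m = T;
  ts_left_svd : forall k : 'I_N, (k < m)%N ->
    is_svd (unfoldL k (L k.+1)) (U k) (DL k) (WL k);
  ts_left_step : forall k : 'I_N, (k < m)%N ->
    L k = modeL (mxH (U k)) (L k.+1);
  ts_right_init : Rt m = T;
  ts_right_svd : forall k : 'I_N, (m <= k)%N ->
    is_svd (unfoldR k (Rt k)) (WR k) (DR k) (V k);
  ts_right_step : forall k : 'I_N, (m <= k)%N ->
    Rt k.+1 = modeR (Rt k) (V k);
  ts_core : S = chainL (left_modes N m) (fun k => mxH (U k)) (Rt N) }.

(* Main.v *)
Require Import Defs.
From HB Require Import structures.
From mathcomp Require Import all_boot all_order all_algebra.
From mathcomp Require Import reals ring.

(* Multiplying an unfolding M = U D W^H by U^H leaves D W^H, whose rows are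
   left orthogonal with norms the singular values; symmetrically on the right.
   For a mode l != k, a unitary left product on l preserves <.,.>_R between
   mode-k slices, a unitary right product on l preserves <.,.>_L, and the two
   inner products have the same real part. The core tensor is obtained from the
   k-th step by unitary products on modes other than k, so the real parts of the
   mode-k Gram matrix are D D^T. For the first (resp. last) mode only right
   (resp. left) products remain after its step, so the full left (resp. right)
   inner product survives. *)

Set Implicit Arguments.
Unset Strict Implicit.
Unset Printing Implicit Defensive.

Import Order.TTheory GRing.Theory Num.Theory.
Local Open Scope ring_scope.

(** * Quaternion components, conjugation and the real embedding as morphisms *)

Section QuaternionMorphisms.
Variable R : realType.
Implicit Types x y : quat R.

(** Registered as additive maps, the four components pass through finite sums by [raddf_sum], hence
    through matrix products and inner products. *)
Lemma qr_is_zmod_morphism : zmod_morphism (@qr R). Proof. by []. Qed.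
Lemma qi_is_zmod_morphism : zmod_morphism (@qi R). Proof. by []. Qed.
Lemma qj_is_zmod_morphism : zmod_morphism (@qj R). Proof. by []. Qed.
Lemma qk_is_zmod_morphism : zmod_morphism (@qk R). Proof. by []. Qed.

HB.instance Definition _ :=
  GRing.isZmodMorphism.Build (quat R) R (@qr R) qr_is_zmod_morphism.
HB.instance Definition _ :=
  GRing.isZmodMorphism.Build (quat R) R (@qi R) qi_is_zmod_morphism.
HB.instance Definition _ :=
  GRing.isZmodMorphism.Build (quat R) R (@qj R) qj_is_zmod_morphism.
HB.instance Definition _ :=
  GRing.isZmodMorphism.Build (quat R) R (@qk R) qk_is_zmod_morphism.

Lemma quat_conj_is_zmod_morphism : zmod_morphism (@quat_conj R).
Proof. by case=> ? ? ? ? [? ? ? ?]; congr Quat => /=; ring. Qed.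

HB.instance Definition _ := GRing.isZmodMorphism.Build (quat R) (quat R)
  (@quat_conj R) quat_conj_is_zmod_morphism.

Lemma quat_conjM x y : quat_conj (x * y) = quat_conj y * quat_conj x.
Proof. by case: x y => ? ? ? ? [? ? ? ?]; congr Quat => /=; ring. Qed.

Lemma quat_conjK : involutive (@quat_conj R).
Proof. by case=> ? ? ? ?; congr Quat => /=; ring. Qed.

Lemma quat_real_is_zmod_morphism : zmod_morphism (@quat_real R).
Proof. by move=> a b; congr Quat => /=; ring. Qed.

(** Makes [map_mxM] available for the embedded real diagonal factors of an SVD. *)
Lemma quat_real_is_monoid_morphism : monoid_morphism (@quat_real R).
Proof. by split=> // a b; congr Quat => /=; ring. Qed.

HB.instance Definition _ := GRing.isZmodMorphism.Build R (quat R)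
  (@quat_real R) quat_real_is_zmod_morphism.
HB.instance Definition _ := GRing.isMonoidMorphism.Build R (quat R)
  (@quat_real R) quat_real_is_monoid_morphism.

Lemma quat_conj_real (a : R) : quat_conj (quat_real a) = quat_real a.
Proof. by congr Quat; rewrite /= oppr0. Qed.

End QuaternionMorphisms.

(** * Algebra of the conjugate transpose *)

Section ConjugateTranspose.
Variable R : realType.

Lemma mxHE p q (A : 'M[quat R]_(p, q)) i j : mxH A i j = quat_conj (A j i).
Proof. by rewrite !mxE. Qed.

Lemma mxHM p q r (A : 'M[quat R]_(p, q)) (B : 'M[quat R]_(q, r)) :
  mxH (A *m B) = mxH B *m mxH A.
Proof.
apply/matrixP => i j; rewrite !mxE raddf_sum.
by apply: eq_bigr => k _; rewrite !mxE -quat_conjM.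
Qed.

Lemma mxHK p q (A : 'M[quat R]_(p, q)) : mxH (mxH A) = A.
Proof. by apply/matrixP => i j; rewrite !mxE quat_conjK. Qed.

Lemma mxH_real p q (D : 'M[R]_(p, q)) :
  mxH (map_mx (@quat_real R) D) = map_mx (@quat_real R) D^T.
Proof. by apply/matrixP => i j; rewrite !mxE quat_conj_real. Qed.

End ConjugateTranspose.

(** * Two-sided inverses of unitary matrices, through real matrices *)

Section RealEmbedding.
Variables (R : realType) (p : nat).
Implicit Types M K : 'M[quat R]_p.

(* The matrix of left multiplication by [M] on [H^p], in the real basis
   [1, i, j, k]. *)
Definition real_mx M : 'M[R]_(p + p + (p + p)) :=
  let A := map_mx (@qr R) M in let B := map_mx (@qi R) M in
  let C := map_mx (@qj R) M in let D := map_mx (@qk R) M in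
  block_mx (block_mx A (- B) B A) (block_mx (- C) (- D) (- D) C)
           (block_mx C D D (- C)) (block_mx A (- B) B A).

(** The first block column consists of the four components [A], [B], [C], [D] of the matrix. *)
Lemma real_mx_inj : injective real_mx.
Proof.
move=> M K /eq_block_mx[/eq_block_mx[eA _ eB _] _ /eq_block_mx[eC eD _ _] _].
apply/matrixP => i j; move: eA eB eC eD.
move=> /matrixP/(_ i j) + /matrixP/(_ i j) + /matrixP/(_ i j) + /matrixP/(_ i j).
by rewrite !mxE; case: (M i j) (K i j) => ? ? ? ? [? ? ? ?] /= -> -> -> ->.
Qed.

Lemma real_mx1 : real_mx 1%:M = 1%:M.
Proof.
have E (f : {additive quat R -> R}) : map_mx f 1%:M = (f 1)%:M :> 'M_p.
  by apply/matrixP => i j; rewrite !mxE raddfMn.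
by rewrite /real_mx !E /= !raddf0 -scalar_mx_block block_mx0 -scalar_mx_block.
Qed.

Lemma real_mxM M K : real_mx (M *m K) = real_mx M *m real_mx K.
Proof.
pose c (f : quat R -> R) (X : 'M[quat R]_p) := map_mx f X.
have [eA eB eC eD] :
  [/\ c (@qr R) (M *m K) = c (@qr R) M *m c (@qr R) K - c (@qi R) M *m c (@qi R) K
        - c (@qj R) M *m c (@qj R) K - c (@qk R) M *m c (@qk R) K,
      c (@qi R) (M *m K) = c (@qr R) M *m c (@qi R) K + c (@qi R) M *m c (@qr R) K
        + c (@qj R) M *m c (@qk R) K - c (@qk R) M *m c (@qj R) K,
      c (@qj R) (M *m K) = c (@qr R) M *m c (@qj R) K - c (@qi R) M *m c (@qk R) K
        + c (@qj R) M *m c (@qr R) K + c (@qk R) M *m c (@qi R) K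
    & c (@qk R) (M *m K) = c (@qr R) M *m c (@qk R) K + c (@qi R) M *m c (@qj R) K
        - c (@qj R) M *m c (@qi R) K + c (@qk R) M *m c (@qr R) K].
  by split; apply/matrixP => i j; rewrite !mxE raddf_sum -!sumrN -!big_split;
     apply: eq_bigr => k _; rewrite !mxE.
rewrite /real_mx /= -!/(c _ _) eA eB eC eD.
move: (c _ M) (c _ M) (c _ M) (c _ M) (c _ K) (c _ K) (c _ K) (c _ K).
move=> {c eA eB eC eD} A B C D A' B' C' D'; rewrite !mulmx_block !add_block_mx.
rewrite !mulmxN !mulNmx !opprK.
(* Entrywise, each product of component matrices is a sum that [ring] treats as an atom; only
   additions and signs are rearranged. *)
congr block_mx; congr block_mx; apply/matrixP => i j; rewrite !mxE; ring.
Qed.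

(* The library has [mulmx1C] only over commutative rings, hence the detour
   through real matrices. *)
Lemma unitary_mulmxH M : unitary M -> M *m mxH M = 1%:M.
Proof.
move=> uM; apply: real_mx_inj; rewrite real_mxM real_mx1.
by apply: mulmx1C; rewrite -real_mxM uM real_mx1.
Qed.

Lemma unitary_mxH M : unitary M -> unitary (mxH M).
Proof. by rewrite /unitary mxHK; apply: unitary_mulmxH. Qed.

End RealEmbedding.

(** * Gram matrices of rectangular diagonal matrices *)

Section Diagonal.
Variable R : realType.

Lemma diag_entry_tr p q (D : 'M[R]_(p, q)) k :
  diag_entry D^T k = diag_entry D k.
Proof.
by rewrite /diag_entry; case: insubP => [? _ _|_]; case: insubP => // ? _ _;
  rewrite mxE.
Qed.

(** Row [a] has at most one nonzero entry, in column [a], so distinct rows have disjoint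
    supports. *)
Lemma diag_mx_gram p q (D : 'M[R]_(p, q)) (a b : 'I_p) : is_diag_mx D ->
  (D *m D^T) a b = diag_entry D a ^+ 2 *+ (a == b).
Proof.
move=> /is_diag_mxP diagD; rewrite mxE /diag_entry valK.
have [<-|ab] := eqVneq a b; last first.
  apply: big1 => j _; rewrite mxE.
  have [ja|ja] := eqVneq (val a) (val j).
    by rewrite (diagD b j) ?mulr0 // -ja eq_sym.
  by rewrite diagD ?mul0r.
case: insubP => [j _ ja|nj].
  rewrite (bigD1 j) //= big1 ?addr0 ?mxE -?expr2 // => l.
  by rewrite -(inj_eq val_inj) ja => lj; rewrite diagD ?mul0r // eq_sym.
(* Row [a] has no diagonal position and vanishes, in agreement with the default value [0] of
   [diag_entry]: this is the case of appended zero singular values. *)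
rewrite expr0n big1 // => j _; rewrite diagD ?mul0r //.
by apply: contra nj => /eqP ->.
Qed.

End Diagonal.

(** * Replacing one coordinate of a multi-index *)

Section SetIndex.
Variables (N : nat) (I : 'I_N -> nat).
Implicit Types (i : Defs.index I) (k l : 'I_N).

Lemma set_index_in k (a : 'I_(I k)) i : set_index a i k = a.
Proof. by rewrite ffunE; apply: dfwith_in. Qed.

Lemma set_index_out k l (a : 'I_(I k)) i : k != l -> set_index a i l = i l.
Proof. by move=> kl; rewrite ffunE; apply: dfwith_out. Qed.

Lemma set_indexK k (a b : 'I_(I k)) i :
  set_index a (set_index b i) = set_index a i.
Proof.
apply/ffunP => l; have [<-|kl] := eqVneq k l; first by rewrite !set_index_in.
by rewrite !set_index_out.
Qed.

Lemma set_index_id k i : set_index (i k) i = i.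
Proof.
apply/ffunP => l; have [<-|kl] := eqVneq k l; first by rewrite set_index_in.
by rewrite set_index_out.
Qed.

Lemma set_indexC k l (a : 'I_(I k)) (b : 'I_(I l)) i : k != l ->
  set_index a (set_index b i) = set_index b (set_index a i).
Proof.
move=> kl; apply/ffunP => j; have [<-|kj] := eqVneq k j.
  by rewrite set_index_in set_index_out 1?eq_sym // set_index_in.
have [<-|lj] := eqVneq l j; last by rewrite !set_index_out.
by rewrite set_index_in set_index_out // set_index_in.
Qed.

End SetIndex.

(** * Multi-indices, unfolding positions and slice indices *)

Section Indices.
Variables (N : nat) (I : 'I_N -> nat).
Implicit Types (i : Defs.index I) (k l : 'I_N).

Lemma unfold_col_set k (a : 'I_(I k)) i :
  unfold_col k (set_index a i) = unfold_col k i.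
Proof. by apply: eq_bigr => l lk; rewrite set_index_out // eq_sym. Qed.

Lemma insert_index_set k (a b : 'I_(I k))
    (i : Defs.index (fun l : 'I_N.-1 => I (lift k l))) :
  set_index a (insert_index b i) = insert_index a i.
Proof.
apply/ffunP => l; case: (unliftP k l) => [j ->|->].
  by rewrite set_index_out ?neq_lift // !insert_index_lift.
by rewrite set_index_in insert_index_in.
Qed.

(** Every mode other than [k] has the form [lift k j]; this identity lets a product along such a
    mode pass to mode-[k] slices. *)
Lemma set_index_insert k (a : 'I_(I k)) (j : 'I_N.-1) (c : 'I_(I (lift k j)))
    (i : Defs.index (fun l : 'I_N.-1 => I (lift k l))) :
  set_index c (insert_index a i) =
  insert_index a (set_index (I := fun l : 'I_N.-1 => I (lift k l)) c i).
Proof.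
pose J (l : 'I_N.-1) := I (lift k l).
apply/ffunP => l; case: (unliftP k l) => [l' ->|->]; last first.
  by rewrite set_index_out 1?eq_sym ?neq_lift // !insert_index_in.
rewrite insert_index_lift; have [<-|jl] := eqVneq j l'.
  by rewrite set_index_in (@set_index_in _ J).
rewrite set_index_out ?(inj_eq lift_inj) // insert_index_lift.
by rewrite (@set_index_out _ J).
Qed.

Lemma insert_index_restrict k i :
  insert_index (i k) [ffun l : 'I_N.-1 => i (lift k l)] = i.
Proof.
apply/ffunP => l; case: (unliftP k l) => [j ->|->].
  by rewrite insert_index_lift ffunE.
by rewrite insert_index_in.
Qed.

Lemma inj_surj_bij (X Y : finType) (f : X -> Y) :
  injective f -> (forall y, exists x, f x = y) -> bijective f.
Proof.
move=> f_inj /fin_all_exists[g fg]; exists g => // x.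
by apply: f_inj; rewrite fg.
Qed.

Lemma unfold_bij k : bijective
  (fun i => (i k, Ordinal (unfold_col_lt k i)) : 'I_(I k) * 'I_(unfold_size I k)).
Proof.
apply: inj_surj_bij => [i i' [ek ec]|[a b]]; first exact: unfold_col_inj ek ec.
have [i [ea eb]] := unfold_col_surj a b; exists i.
by congr pair => //; apply: val_inj.
Qed.

(** Turns a sum over the columns of the mode-[k] unfolding into a sum over the entries of a slice.
    Any [a] serves, because the column number ignores the [k]-th coordinate. *)
Lemma insert_col_bij k (a : 'I_(I k)) :
  bijective (fun i : Defs.index _ => Ordinal (unfold_col_lt k (insert_index a i))).
Proof.
apply: inj_surj_bij => [i i' [ec]|b].
  apply/ffunP => l; rewrite -(insert_index_lift a i) -(insert_index_lift a i').
  by rewrite (@unfold_col_inj _ _ k _ (insert_index a i') _ ec) ?insert_index_in.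
have [i [ea eb]] := unfold_col_surj a b.
exists [ffun l : 'I_N.-1 => i (lift k l)]; apply: val_inj => /=.
by rewrite -ea insert_index_restrict.
Qed.

End Indices.

(** * Mode products as matrix products, their chains and their inversion *)

Section ModeProducts.
Variables (R : realType) (N : nat) (I : 'I_N -> nat).
Implicit Types (A B T : tensor R I) (i : Defs.index I) (k l : 'I_N).

Lemma unfoldL_col k T (a : 'I_(I k)) i :
  unfoldL k T a (Ordinal (unfold_col_lt k i)) = T (set_index a i).
Proof.
rewrite -(unfoldLE k T (set_index a i)) set_index_in.
by congr (unfoldL _ _ _ _); apply: val_inj; rewrite /= unfold_col_set.
Qed.

Lemma unfoldR_col k T (a : 'I_(I k)) i :
  unfoldR k T (Ordinal (unfold_col_lt k i)) a = T (set_index a i).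
Proof. by rewrite mxE unfoldL_col. Qed.

(** A product along mode [k] changes only the [k]-th coordinate, so it mixes entries within a single
    column. *)
Lemma unfoldL_modeL k (M : 'M[quat R]_(I k)) T :
  unfoldL k (modeL M T) = M *m unfoldL k T.
Proof.
apply/matrixP => a b; have [i [_ eb]] := unfold_col_surj a b.
have -> : b = Ordinal (unfold_col_lt k i) by apply: val_inj.
rewrite unfoldL_col ffunE mxE set_index_in; apply: eq_bigr => c _.
by rewrite unfoldL_col set_indexK.
Qed.

Lemma unfoldR_modeR k T (M : 'M[quat R]_(I k)) :
  unfoldR k (modeR T M) = unfoldR k T *m M.
Proof.
apply/matrixP => b a; have [i [_ eb]] := unfold_col_surj a b.
have -> : b = Ordinal (unfold_col_lt k i) by apply: val_inj.
rewrite unfoldR_col ffunE mxE set_index_in; apply: eq_bigr => c _.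
by rewrite unfoldR_col set_indexK.
Qed.

Lemma unfoldL_inj k : injective (@unfoldL R N I k).
Proof.
by move=> A B eAB; apply/ffunP => i; rewrite -!(unfoldLE k) eAB.
Qed.

Lemma modeLK k (M K : 'M[quat R]_(I k)) T :
  M *m K = 1%:M -> modeL M (modeL K T) = T.
Proof.
move=> MK; apply: (@unfoldL_inj k); rewrite !unfoldL_modeL mulmxA MK.
exact: mul1mx.
Qed.

Lemma modeRK k (M K : 'M[quat R]_(I k)) T :
  M *m K = 1%:M -> modeR (modeR T M) K = T.
Proof.
move=> MK; apply: (@unfoldL_inj k); apply: trmx_inj.
by rewrite -!/(unfoldR _ _) !unfoldR_modeR -mulmxA MK mulmx1.
Qed.

(** Only associativity and an exchange of sums are used: the left factor stays on the left of the
    tensor entry and the right factor on its right. Two left products along distinct modes do not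
    commute in general. *)
Lemma modeLR k l (M : 'M[quat R]_(I k)) T (K : 'M[quat R]_(I l)) : k != l ->
  modeL M (modeR T K) = modeR (modeL M T) K.
Proof.
move=> kl; apply/ffunP => i; rewrite !ffunE.
under eq_bigr do rewrite ffunE mulr_sumr.
rewrite exchange_big; apply: eq_bigr => c _.
rewrite ffunE mulr_suml; apply: eq_bigr => d _.
rewrite mulrA (set_indexC _ _ _ kl) (set_index_out _ _ kl).
by rewrite set_index_out 1?eq_sym.
Qed.

Lemma chainLR (s t : seq 'I_N) M T (K : forall k, 'M[quat R]_(I k)) :
  {in s & t, forall k l, k != l} ->
  chainL s M (chainR t T K) = chainR t (chainL s M T) K.
Proof.
have modeL_chainR k (P : 'M_(I k)) X : {in t, forall l, k != l} ->
    modeL P (chainR t X K) = chainR t (modeL P X) K.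
  elim: t X => //= l t IHt X kt; rewrite IHt ?modeLR ?kt ?mem_head // => j jt.
  by rewrite kt // inE jt orbT.
elim: s => //= k s IHs st; rewrite IHs.
  by rewrite modeL_chainR // => l lt; rewrite st ?mem_head.
by move=> j l js; apply: st; rewrite inE js orbT.
Qed.

(** The reversal makes the innermost product of the outer chain meet the outermost product of the
    inner one, so the pairs cancel from the middle without any commutation. *)
Lemma chainLK (s : seq 'I_N) (M K : forall k, 'M[quat R]_(I k)) T :
  {in s, forall k, M k *m K k = 1%:M} -> chainL (rev s) M (chainL s K T) = T.
Proof.
rewrite /chainL; elim: s => //= k s IHs MK.
rewrite rev_cons foldr_rcons modeLK ?MK ?mem_head // IHs // => l ls.
by rewrite MK // inE ls orbT.
Qed.

Lemma chainRK (s : seq 'I_N) (M K : forall k, 'M[quat R]_(I k)) T :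
  {in s, forall k, M k *m K k = 1%:M} -> chainR (rev s) (chainR s T M) K = T.
Proof.
rewrite /chainR; elim: s T => //= k s IHs T MK.
rewrite rev_cons foldl_rcons IHs ?modeRK ?MK ?mem_head // => l ls.
by rewrite MK // inE ls orbT.
Qed.

End ModeProducts.

(** * Inner products of tensors and slices, and their invariance *)

Section InnerProducts.
Variable R : realType.

(** Holds term by term, since [Re (x y) = Re (y x)] and conjugation preserves real parts. It allows
    switching between the two invariances below, at the cost of the imaginary parts. *)
Lemma qr_innerLR N (I : 'I_N -> nat) (A B : tensor R I) :
  qr (innerL A B) = qr (innerR A B).
Proof.
rewrite /innerL /innerR !raddf_sum; apply: eq_bigr => i _.
by case: (A i) (B i) => ? ? ? ? [? ? ? ?] /=; ring.
Qed.

(** The right inner product is paired with the left unfolding so that a left factor [M] on both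
    tensors produces [mxH M *m M] in the middle of the product. *)
Lemma innerR_unfoldL N (I : 'I_N -> nat) k (A B : tensor R I) :
  innerR A B = \tr (mxH (unfoldL k A) *m unfoldL k B).
Proof.
rewrite /mxtrace; under eq_bigr do rewrite mxE.
rewrite exchange_big pair_big /innerR.
rewrite [RHS](reindex _ (onW_bij _ (unfold_bij I k))).
by apply: eq_bigr => i _; rewrite mxHE /= !unfoldL_col set_index_id.
Qed.

Lemma innerL_unfoldR N (I : 'I_N -> nat) k (A B : tensor R I) :
  innerL A B = \tr (unfoldR k A *m mxH (unfoldR k B)).
Proof.
rewrite /mxtrace; under eq_bigr do rewrite mxE.
rewrite exchange_big pair_big /innerL.
rewrite [RHS](reindex _ (onW_bij _ (unfold_bij I k))).
by apply: eq_bigr => i _; rewrite mxHE /= !unfoldR_col set_index_id.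
Qed.

Lemma innerR_modeL N (I : 'I_N -> nat) k (M : 'M[quat R]_(I k))
    (A B : tensor R I) :
  unitary M -> innerR (modeL M A) (modeL M B) = innerR A B.
Proof.
move=> uM; rewrite !(innerR_unfoldL k) !unfoldL_modeL mxHM -mulmxA.
by rewrite (mulmxA (mxH M)) uM mul1mx.
Qed.

Lemma innerL_modeR N (I : 'I_N -> nat) k (M : 'M[quat R]_(I k))
    (A B : tensor R I) :
  unitary M -> innerL (modeR A M) (modeR B M) = innerL A B.
Proof.
move=> uM; rewrite !(innerL_unfoldR k) !unfoldR_modeR mxHM -mulmxA.
(* The factors meet as [M *m mxH M], so the other side of unitarity is required. *)
by rewrite (mulmxA M) unitary_mulmxH // mul1mx.
Qed.

Variables (N : nat) (I : 'I_N -> nat).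
Implicit Types (A B T X : tensor R I) (k l : 'I_N).

(** Mode-[k] slices are the rows of the left unfolding, so their inner products form its Gram
    matrix. *)
Lemma innerL_slice k (a b : 'I_(I k)) A B :
  innerL (slice k a A) (slice k b B) =
  (unfoldL k A *m mxH (unfoldL k B)) a b.
Proof.
rewrite mxE (reindex _ (onW_bij _ (insert_col_bij a))).
by apply: eq_bigr => i _; rewrite mxHE !ffunE !unfoldL_col !insert_index_set.
Qed.

Lemma innerR_slice k (a b : 'I_(I k)) A B :
  innerR (slice k a A) (slice k b B) =
  (mxH (unfoldR k A) *m unfoldR k B) a b.
Proof.
rewrite mxE (reindex _ (onW_bij _ (insert_col_bij a))).
by apply: eq_bigr => i _; rewrite mxHE !ffunE !unfoldR_col !insert_index_set.
Qed.

Lemma slice_modeL k (a : 'I_(I k)) (j : 'I_N.-1)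
    (M : 'M[quat R]_(I (lift k j))) T :
  slice k a (modeL M T) =
  modeL (I := fun l : 'I_N.-1 => I (lift k l)) M (slice k a T).
Proof.
apply/ffunP => i; rewrite 2![LHS]ffunE [RHS]ffunE insert_index_lift.
by apply: eq_bigr => c _; rewrite ffunE set_index_insert.
Qed.

Lemma slice_modeR k (a : 'I_(I k)) (j : 'I_N.-1)
    (M : 'M[quat R]_(I (lift k j))) T :
  slice k a (modeR T M) =
  modeR (I := fun l : 'I_N.-1 => I (lift k l)) (slice k a T) M.
Proof.
apply/ffunP => i; rewrite 2![LHS]ffunE [RHS]ffunE insert_index_lift.
by apply: eq_bigr => c _; rewrite ffunE set_index_insert.
Qed.

Lemma innerR_slice_modeL k l (a b : 'I_(I k)) (M : 'M[quat R]_(I l)) A B :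
  k != l -> unitary M ->
  innerR (slice k a (modeL M A)) (slice k b (modeL M B)) =
  innerR (slice k a A) (slice k b B).
Proof.
(* The type of [M] depends on [l], hence its generalization; a mode [l] different from [k] becomes
   the mode [j] of the slice. *)
case: (unliftP k l) M => [j ->|->] M; last by rewrite eqxx.
by move=> _ uM; rewrite !slice_modeL innerR_modeL.
Qed.

Lemma innerL_slice_modeR k l (a b : 'I_(I k)) (M : 'M[quat R]_(I l)) A B :
  k != l -> unitary M ->
  innerL (slice k a (modeR A M)) (slice k b (modeR B M)) =
  innerL (slice k a A) (slice k b B).
Proof.
case: (unliftP k l) M => [j ->|->] M; last by rewrite eqxx.
by move=> _ uM; rewrite !slice_modeR innerL_modeR.
Qed.

Lemma innerR_slice_chainL k (a b : 'I_(I k)) s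
    (M : forall l, 'M[quat R]_(I l)) A B :
  {in s, forall l, k != l /\ unitary (M l)} ->
  innerR (slice k a (chainL s M A)) (slice k b (chainL s M B)) =
  innerR (slice k a A) (slice k b B).
Proof.
elim: s => //= l s IHs ok; have [kl uM] := ok l (mem_head _ _).
rewrite innerR_slice_modeL // IHs // => j js.
by apply: ok; rewrite inE js orbT.
Qed.

Lemma innerL_slice_chainR k (a b : 'I_(I k)) s
    (M : forall l, 'M[quat R]_(I l)) A B :
  {in s, forall l, k != l /\ unitary (M l)} ->
  innerL (slice k a (chainR s A M)) (slice k b (chainR s B M)) =
  innerL (slice k a A) (slice k b B).
Proof.
elim: s A B => //= l s IHs A B ok; have [kl uM] := ok l (mem_head _ _).
rewrite IHs ?innerL_slice_modeR // => j js.
by apply: ok; rewrite inE js orbT.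
Qed.

End InnerProducts.

(** * Peeling one mode off the lists of left and right modes *)

Section Modes.
Variable N : nat.

Lemma left_modes0 : left_modes N 0 = [::].
Proof. by rewrite /left_modes filter_pred0. Qed.

(** Proved on underlying numbers, where the left modes form an interval [iota 0 n]; [val] is
    injective. *)
Lemma left_modesS n (nN : (n < N)%N) :
  left_modes N n.+1 = rcons (left_modes N n) (Ordinal nN).
Proof.
have E j : (j <= N)%N -> map val (left_modes N j) = iota 0 j.
  move=> jN; rewrite -(filter_map val (fun k => k < j)%N) val_enum_ord.
  exact: (@filter_iota_ltn 0 N j).
apply: (inj_map val_inj); rewrite map_rcons !E ?(ltnW nN) //.
by rewrite -addn1 iotaD cats1.
Qed.

Lemma right_modesN : right_modes N N = [::].
Proof.
apply/eqP; rewrite -[_ == _]negbK -has_filter -all_predC; apply/allP => k _.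
by rewrite /= -ltnNge.
Qed.

Lemma right_modesS n (nN : (n < N)%N) :
  right_modes N n = Ordinal nN :: right_modes N n.+1.
Proof.
have E j : (j <= N)%N -> map val (right_modes N j) = iota j (N - j).
  move=> jN; rewrite -(filter_map val (fun k => j <= k)%N) val_enum_ord.
  (* The interval is split at [j]: the filter empties the first part and keeps all of the second. *)
  rewrite -{1}(subnKC jN) iotaD filter_cat (@eq_in_filter _ _ pred0) => [|x].
    rewrite filter_pred0; apply/all_filterP/allP => x.
    by rewrite mem_iota => /andP[].
  by rewrite mem_iota => /andP[_]; rewrite ltnNge => /negPf.
apply: (inj_map val_inj); rewrite map_cons !E ?(ltnW nN) //=.
by rewrite -[in LHS](subnSK nN).
Qed.

End Modes.

(** * Gram matrices of the core tensor *)

Section CoreTensor.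
Variables (R : realType) (N : nat) (I : 'I_N -> nat).
Implicit Types (T X S : tensor R I) (k : 'I_N).

(** The innermost product of the chain is the first step of the left sweep, so the chain runs
    through the whole sweep down to [L 0]. *)
Lemma chainL_left_modes (M : forall k, 'M[quat R]_(I k)) (L : nat -> tensor R I) m :
  (m <= N)%N -> (forall k, (k < m)%N -> L k = modeL (M k) (L k.+1)) ->
  chainL (left_modes N m) M (L m) = L 0%N.
Proof.
elim: m => [|m IHm] mN stepL; first by rewrite left_modes0.
rewrite (left_modesS mN) /chainL foldr_rcons -(stepL (Ordinal mN)) //.
by apply: IHm => [|k km]; [apply: ltnW | apply/stepL/ltnW].
Qed.

Lemma chainR_right_modes (M : forall k, 'M[quat R]_(I k)) (L : nat -> tensor R I) m :
  (m <= N)%N -> (forall k, (m <= k)%N -> L k.+1 = modeR (L k) (M k)) ->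
  chainR (right_modes N m) (L m) M = L N.
Proof.
(* Induction on [N - m], the number of right products, as the chain is peeled at its first mode
   [m]. *)
move=> mN; rewrite -{1 2 3}(subKn mN); have: (N - m <= N)%N by apply: leq_subr.
elim: (N - m)%N => [|n IHn] nN stepR; first by rewrite subn0 right_modesN.
have lt : (N - n.+1 < N)%N by rewrite ltn_subrL (leq_ltn_trans _ nN).
rewrite (right_modesS lt) /= -(stepR (Ordinal lt)) //= (subnSK nN).
apply: IHn => [|k]; first exact: ltnW.
by move=> nk; apply: stepR; apply: leq_trans nk; rewrite leq_sub2l.
Qed.

(** The full quaternion value is computed, not only its real part: the first mode needs it. *)
Lemma svd_innerL_slice k X (P : 'M[quat R]_(I k)) D W (a b : 'I_(I k)) :
  is_svd (unfoldL k X) P D W ->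
  innerL (slice k a (modeL (mxH P) X)) (slice k b (modeL (mxH P) X)) =
  quat_real (diag_entry D a ^+ 2 *+ (a == b)).
Proof.
case=> uP uW diagD _ _ eX.
rewrite innerL_slice unfoldL_modeL eX 2!mulmxA uP mul1mx.
rewrite mxHM mxHK -mulmxA (mulmxA (mxH W)) uW mul1mx mxH_real.
by rewrite -map_mxM mxE diag_mx_gram.
Qed.

Lemma svd_innerR_slice k X W D (P : 'M[quat R]_(I k)) (a b : 'I_(I k)) :
  is_svd (unfoldR k X) W D P ->
  innerR (slice k a (modeR X P)) (slice k b (modeR X P)) =
  quat_real (diag_entry D a ^+ 2 *+ (a == b)).
Proof.
case=> uW uP diagD _ _ eX.
rewrite innerR_slice unfoldR_modeR eX -mulmxA uP mulmx1.
rewrite mxHM -mulmxA (mulmxA (mxH W)) uW mul1mx mxH_real -map_mxM mxE.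
(* The Gram matrix here is [D^T *m D], which is brought to the form of [diag_mx_gram] for [D^T]. *)
by rewrite -{2}(trmxK D) diag_mx_gram ?diag_entry_tr ?is_diag_trmx.
Qed.

(** Shared by left and right modes. Real parts of the Gram matrix suffice, because the squared norm
    is the real part of a diagonal entry. *)
Lemma normF_slice_ordered k S (d : nat -> R) :
    (forall n, 0 <= d n) -> (forall n l, (n <= l)%N -> d l <= d n) ->
    (forall a b : 'I_(I k),
      qr (innerL (slice k a S) (slice k b S)) = d a ^+ 2 *+ (a == b)) ->
  [/\ forall a : 'I_(I k), normF (slice k a S) = d a,
      forall a b : 'I_(I k), (a <= b)%N ->
        normF (slice k a S) >= normF (slice k b S)
    & forall a : 'I_(I k), normF (slice k a S) >= 0].
Proof.
move=> d_ge0 d_sorted gramS.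
have normS a : normF (slice k a S) = d a.
  by rewrite /normF gramS eqxx sqrtr_sqr ger0_norm.
by split=> [|a b ab|a]; rewrite ?normS // d_sorted.
Qed.

Variables (m : nat) (T S : tensor R I) (L Rt : nat -> tensor R I).
Variables (U V : forall k : 'I_N, 'M[quat R]_(I k)).
Variables (DL : forall k : 'I_N, 'M[R]_(I k, unfold_size I k)).
Variables (WL WR : forall k : 'I_N, 'M[quat R]_(unfold_size I k)).
Variables (DR : forall k : 'I_N, 'M[R]_(unfold_size I k, I k)).
Hypotheses (mN : (m <= N)%N) (HS : ts_qhosvd m T L Rt U DL WL V DR WR S).

Lemma left_modes_unitary : {in left_modes N m, forall k, unitary (U k)}.
Proof.
by move=> k; rewrite mem_filter => /andP[km _]; case: (ts_left_svd HS km).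
Qed.

Lemma right_modes_unitary : {in right_modes N m, forall k, unitary (V k)}.
Proof.
by move=> k; rewrite mem_filter => /andP[km _]; case: (ts_right_svd HS km).
Qed.

Lemma right_modes_chain : chainR (right_modes N m) T V = Rt N.
Proof.
by rewrite -(ts_right_init HS) (chainR_right_modes mN (ts_right_step HS)).
Qed.

(** Moving the left products inside the right ones presents the core as right products applied to
    [L 0], the form in which left inner products of slices survive. *)
Lemma core_chainR : S = chainR (right_modes N m) (L 0) V.
Proof.
rewrite (ts_core HS) -right_modes_chain chainLR => [|k l].
  rewrite -{1}(ts_left_init HS).
  by rewrite (chainL_left_modes mN (ts_left_step HS)).
rewrite !mem_filter => /andP[km _] /andP[lm _].
by apply: contraTneq km => ->; rewrite -leqNgt.
Qed.

Lemma tensor_of_core :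
  T = chainR (rev (right_modes N m)) (chainL (rev (left_modes N m)) U S)
        (fun k => mxH (V k)).
Proof.
rewrite (ts_core HS) chainLK => [|k /left_modes_unitary/unitary_mulmxH //].
rewrite -right_modes_chain chainRK // => k /right_modes_unitary.
exact: unitary_mulmxH.
Qed.

Lemma left_gram k (a b : 'I_(I k)) : (k < m)%N ->
  qr (innerL (slice k a S) (slice k b S)) =
  diag_entry (DL k) a ^+ 2 *+ (a == b).
Proof.
move=> km; rewrite core_chainR innerL_slice_chainR => [|l lm]; last first.
  split; last exact: right_modes_unitary.
  by apply: contraTneq lm => <-; rewrite mem_filter negb_and -ltnNge km.
(* From [L k] down to [L 0] only left products along modes below [k] occur. They preserve [innerR],
   so the real part of [innerL] is unchanged. *)
have E n : (n <= k)%N -> qr (innerL (slice k a (L 0)) (slice k b (L 0))) =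
    qr (innerL (slice k a (L n)) (slice k b (L n))).
  elim: n => // n IHn nk; rewrite IHn ?(ltnW nk) //.
  have nm := ltn_trans nk km; have nN := leq_trans nm mN.
  rewrite (ts_left_step HS (k := Ordinal nN)) // !qr_innerLR.
  rewrite innerR_slice_modeL //; first by rewrite -(inj_eq val_inj) /= gtn_eqF.
  by apply: unitary_mxH; case: (ts_left_svd HS (k := Ordinal nN) nm).
by rewrite (E k) // (ts_left_step HS km) (svd_innerL_slice _ _ (ts_left_svd HS km)).
Qed.

Lemma right_gram k (a b : 'I_(I k)) : (m <= k)%N ->
  qr (innerL (slice k a S) (slice k b S)) =
  diag_entry (DR k) a ^+ 2 *+ (a == b).
Proof.
move=> mk; rewrite qr_innerLR (ts_core HS).
rewrite innerR_slice_chainL => [|l lm]; last first.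
  split; last exact/unitary_mxH/left_modes_unitary.
  by apply: contraTneq lm => <-; rewrite mem_filter negb_and -leqNgt mk.
(* The comparison starts at [Rt k.+1], the result of the product along mode [k] itself; the later
   right products act on other modes. *)
have E n : (k < n)%N -> (n <= N)%N ->
    qr (innerL (slice k a (Rt n)) (slice k b (Rt n))) =
    qr (innerL (slice k a (Rt k.+1)) (slice k b (Rt k.+1))).
  elim: n => // n IHn; rewrite ltnS leq_eqVlt => /predU1P[->|kn] nN //.
  rewrite -(IHn kn (ltnW nN)) (ts_right_step HS (k := Ordinal nN)) /=.
    rewrite innerL_slice_modeR //; first by rewrite -(inj_eq val_inj) /= ltn_eqF.
    by case: (ts_right_svd HS (k := Ordinal nN) (leq_trans mk (ltnW kn))).
  exact: leq_trans mk (ltnW kn).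
rewrite -qr_innerLR (E N) // qr_innerLR (ts_right_step HS mk).
by rewrite (svd_innerR_slice _ _ (ts_right_svd HS mk)).
Qed.

Lemma first_mode_orthogonal k (a b : 'I_(I k)) : (0 < m)%N -> k = 0%N :> nat ->
  a != b -> innerL (slice k a S) (slice k b S) = 0.
Proof.
move=> m0 k0 ab; have km : (k < m)%N by rewrite k0.
rewrite core_chainR innerL_slice_chainR => [|l lm]; last first.
  split; last exact: right_modes_unitary.
  by apply: contraTneq lm => <-; rewrite mem_filter negb_and -ltnNge km.
(* Mode [0] comes last in the left sweep, so [L 0] is directly the output of its SVD step and no
   passage to real parts occurs. *)
rewrite -[X in L X]k0 (ts_left_step HS km).
by rewrite (svd_innerL_slice _ _ (ts_left_svd HS km)) (negPf ab).
Qed.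

Lemma last_mode_orthogonal k (a b : 'I_(I k)) : (m < N)%N -> k = N.-1 :> nat ->
  a != b -> innerR (slice k a S) (slice k b S) = 0.
Proof.
move=> ltmN kN ab; have eN : N = k.+1 by rewrite kN (ltn_predK ltmN).
have mk : (m <= k)%N by rewrite -ltnS -eN.
rewrite (ts_core HS) innerR_slice_chainL => [|l lm]; last first.
  split; last exact/unitary_mxH/left_modes_unitary.
  by apply: contraTneq lm => <-; rewrite mem_filter negb_and -leqNgt mk.
(* Likewise [Rt N] is the direct output of the step at the last mode, as [N = k.+1]. *)
rewrite [X in Rt X]eN (ts_right_step HS mk).
by rewrite (svd_innerR_slice _ _ (ts_right_svd HS mk)) (negPf ab).
Qed.

End CoreTensor.

Theorem theorem4 (R : realType) (m N : nat) (m_ge1 : (1 <= m)%N)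
    (N_eq : N = (2 * m)%N) (I : 'I_N -> nat) (T : tensor R I)
    (L Rt : nat -> tensor R I)
    (U : forall k : 'I_N, 'M[quat R]_(I k))
    (DL : forall k : 'I_N, 'M[R]_(I k, unfold_size I k))
    (WL : forall k : 'I_N, 'M[quat R]_(unfold_size I k))
    (V : forall k : 'I_N, 'M[quat R]_(I k))
    (DR : forall k : 'I_N, 'M[R]_(unfold_size I k, I k))
    (WR : forall k : 'I_N, 'M[quat R]_(unfold_size I k))
    (S : tensor R I)
    (HS : ts_qhosvd m T L Rt U DL WL V DR WR S) :
  T = chainR (rev (right_modes N m))
        (chainL (rev (left_modes N m)) U S)
        (fun k => mxH (V k))
  /\ (forall p : 'I_N, (p < m)%N ->
        [/\ forall a : 'I_(I p), normF (slice p a S) = diag_entry (DL p) a,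
            forall a b : 'I_(I p), (a <= b)%N ->
              normF (slice p a S) >= normF (slice p b S)
          & forall a : 'I_(I p), normF (slice p a S) >= 0])
  /\ (forall q : 'I_N, (m <= q)%N ->
        [/\ forall a : 'I_(I q), normF (slice q a S) = diag_entry (DR q) a,
            forall a b : 'I_(I q), (a <= b)%N ->
              normF (slice q a S) >= normF (slice q b S)
          & forall a : 'I_(I q), normF (slice q a S) >= 0])
  /\ (forall k : 'I_N, k = 0%N :> nat -> forall a b : 'I_(I k), a != b ->
        innerL (slice k a S) (slice k b S) = 0)
  /\ (forall k : 'I_N, k = N.-1 :> nat -> forall a b : 'I_(I k), a != b ->
        innerR (slice k a S) (slice k b S) = 0)
  /\ (forall (k : 'I_N) (a b : 'I_(I k)), a != b ->
        qr (innerL (slice k a S) (slice k b S)) = 0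
        /\ qr (innerR (slice k a S) (slice k b S)) = 0).
Proof.
have mN : (m <= N)%N by rewrite N_eq leq_pmull.
(* Strictness comes from [1 <= m] and guarantees that the last mode is a right mode. *)
have ltmN : (m < N)%N by rewrite N_eq mul2n -addnn -[X in (X < _)%N]addn0 ltn_add2l.
split; first exact: tensor_of_core HS.
split=> [p pm|].
  have [_ _ _ d_ge0 d_sorted _] := ts_left_svd HS pm.
  by apply: normF_slice_ordered => // a b; apply: (left_gram mN HS).
split=> [q mq|].
  have [_ _ _ d_ge0 d_sorted _] := ts_right_svd HS mq.
  by apply: normF_slice_ordered => // a b; apply: (right_gram HS).
split=> [k k0 a b|]; first exact: (first_mode_orthogonal mN HS).
split=> [k kN a b|k a b /negPf ab]; first exact: (last_mode_orthogonal HS).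
rewrite -qr_innerLR; have [km|mk] := ltnP k m.
  by rewrite (left_gram mN HS) // ab.
by rewrite (right_gram HS) // ab.
Qed.
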